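(* Let $\Theta$ be a rectangular subspace of $\mathbb{R}^p$. Let $\phi=(\phi_1,\ldots,\phi_p):\Theta\to\mathbb{R}^p$ be a differentiable vector-valued function, and assume that the order of integration and differentiation in $\phi$ can be interchanged, i.e. $\int(\partial\phi(\theta)/\partial\theta)\,d\theta=\partial\left(\int\phi(\theta)\,d\theta\right)/\partial\theta$ holds. Then a twice-differentiable prior density $\pi(\theta)$ on $\Theta$ satisfying $$\frac{\partial\log\pi(\theta)}{\partial\theta}=\phi(\theta)$$ exists if and only if $$\frac{\partial\phi_t(\theta)}{\partial\theta_u}=\frac{\partial\phi_u(\theta)}{\partial\theta_t}\quad(t,u=1,\ldots,p).$$
   Context: ''Prior density'' is understood in the generalized sense: $\pi$ is a positive function on $\Theta$, determined up to a multiplicative constant, and may be improper (its integral over $\Theta$ may be infinite). The interchange assumption means that derivatives of $\phi$ with respect to one coordinate may be taken under the integral sign for integrals of $\phi$ over other coordinates. *)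

(* Defs.v *)
From HB Require Import structures.
From mathcomp Require Import all_boot all_order all_algebra.
From mathcomp Require Import all_classical all_reals all_analysis.

Set Implicit Arguments.
Unset Strict Implicit.
Unset Printing Implicit Defensive.
Import Order.TTheory GRing.Theory Num.Theory.
Import numFieldNormedType.Exports.

Local Open Scope classical_set_scope.
Local Open Scope ring_scope.

Definition rectangle (R : realType) (p : nat) (a b : 'I_p -> \bar R) :
    set 'rV[R]_p :=
  [set theta | forall i, (a i < (theta ord0 i)%:E < b i)%E].

Definition partial (R : realType) (p : nat) (i : 'I_p)
    (f : 'rV[R]_p -> R) (theta : 'rV[R]_p) : R :=
  'D_(delta_mx ord0 i) f theta.

Definition gradient (R : realType) (p : nat)
    (f : 'rV[R]_p -> R) (theta : 'rV[R]_p) : 'rV[R]_p :=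
  \row_i partial i f theta.

Definition component (R : realType) (p : nat)
    (phi : 'rV[R]_p -> 'rV[R]_p) (t : 'I_p) (theta : 'rV[R]_p) : R :=
  phi theta ord0 t.

(* Meant for an open set Theta: functions are total on R^p, and only their
   values on Theta matter. *)
Definition differentiable_on (R : realType) (p : nat)
    (V : normedModType R) (Theta : set 'rV[R]_p) (f : 'rV[R]_p -> V) : Prop :=
  forall theta, Theta theta -> differentiable f theta.

Definition twice_differentiable_on (R : realType) (p : nat)
    (Theta : set 'rV[R]_p) (f : 'rV[R]_p -> R) : Prop :=
  differentiable_on Theta f /\ differentiable_on Theta (gradient f).

(* A prior may be improper and is only defined up to a positive factor, hence no
   normalization; differentiable priors are automatically measurable. *)
Definition prior_density (R : realType) (p : nat)
    (Theta : set 'rV[R]_p) (pi : 'rV[R]_p -> R) : Prop :=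
  forall theta, Theta theta -> 0 < pi theta.

Definition set_coord (R : realType) (p : nat)
    (theta : 'rV[R]_p) (s : 'I_p) (x : R) : 'rV[R]_p :=
  \row_j (if j == s then x else theta ord0 j).

(* Integrals are over segments lying in Theta, since the integral of phi over
   the whole side of the rectangle need not converge. Integrability of phi_t
   itself is not required: phi will be continuous on Theta. *)
Definition diff_int_interchange (R : realType) (p : nat)
    (Theta : set 'rV[R]_p) (phi : 'rV[R]_p -> 'rV[R]_p) : Prop :=
  forall (t u s : 'I_p), u != s ->
  forall (theta : 'rV[R]_p) (a b : R), a <= b ->
    Theta (set_coord theta s a) -> Theta (set_coord theta s b) ->
    [/\ (@lebesgue_measure R).-integrable `[a, b]
          (fun x => (partial u (component phi t) (set_coord theta s x))%:E),
        derivable (fun eta : 'rV[R]_p =>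
            \int[@lebesgue_measure R]_(x in `[a, b])
              component phi t (set_coord eta s x))
          theta (delta_mx ord0 u) &
        \int[@lebesgue_measure R]_(x in `[a, b])
            partial u (component phi t) (set_coord theta s x) =
        partial u (fun eta : 'rV[R]_p =>
            \int[@lebesgue_measure R]_(x in `[a, b])
              component phi t (set_coord eta s x)) theta].

(* Main.v *)
(* Let circ(x, y, z) be the integral of phi along the boundary of the triangle
   x y z. Near a point p where phi is differentiable with differential L,
   circ(x, y, z) is (<L(y - x), z - x> - <L(z - x), y - x>) / 2 up to o(d^2),
   where d bounds the distances of x, y, z to p. So if log pi is a potential of phi,
   circ vanishes and letting triangles shrink to p shows that L is symmetric.
   Conversely, if L is symmetric everywhere, circ is o(d^2) near every point and
   Goursat's repeated bisection of a triangle gives circ = 0 on the whole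
   rectangle; the integral of phi along the segment from a base point is then a
   potential F of phi, and pi = exp F. *)
Require Import Defs.
From HB Require Import structures.
From mathcomp Require Import all_boot all_order all_algebra.
From mathcomp Require Import all_classical all_reals all_analysis.
From mathcomp Require Import ring lra.
Set Implicit Arguments.
Unset Strict Implicit.
Unset Printing Implicit Defensive.
Import Order.TTheory GRing.Theory Num.Theory.
Import numFieldNormedType.Exports.
Local Open Scope classical_set_scope.
Local Open Scope ring_scope.

(** * The Euclidean scalar product on row vectors and its bound in the sup norm *)

Section ScalarProduct.
Context {R : realType} {n : nat}.
Implicit Types v w : 'rV[R]_n.

Definition dot v w : R := \sum_i v ord0 i * w ord0 i.

Lemma dot_is_linear v : linear (dot v).
Proof.
move=> k x y; rewrite /dot scaler_sumr -big_split; apply: eq_bigr => i _ /=.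
by rewrite !mxE mulrDr mulrCA.
Qed.

HB.instance Definition _ v :=
  GRing.isLinear.Build R 'rV[R]_n R _ (dot v) (dot_is_linear v).

Lemma dotC v w : dot v w = dot w v.
Proof. by apply: eq_bigr => i _; rewrite mulrC. Qed.

Lemma dotDl v1 v2 w : dot (v1 + v2) w = dot v1 w + dot v2 w.
Proof. by rewrite dotC linearD /= !(dotC w). Qed.

Lemma dotBl v1 v2 w : dot (v1 - v2) w = dot v1 w - dot v2 w.
Proof. by rewrite dotC linearB /= !(dotC w). Qed.

Lemma dotNl v w : dot (- v) w = - dot v w.
Proof. by rewrite dotC linearN /= (dotC w). Qed.

Lemma dotZl k v w : dot (k *: v) w = k * dot v w.
Proof. by rewrite dotC linearZ /= (dotC w). Qed.

Lemma dotZr k v w : dot v (k *: w) = k * dot v w.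
Proof. by rewrite dotC dotZl dotC. Qed.

Lemma coord_le_norm v i : `|v ord0 i| <= `|v|.
Proof.
rewrite [leRHS]mx_normrE.
exact: (le_bigmax _ (fun ij : 'I_1 * 'I_n => `|v ij.1 ij.2|) (ord0, i)).
Qed.

Lemma dot_le_norm v w : `|dot v w| <= n%:R * (`|v| * `|w|).
Proof.
apply: (le_trans (ler_norm_sum _ _ _)).
rewrite -[X in X%:R * _]card_ord mulr_natl -sumr_const.
by apply: ler_sum => i _; rewrite normrM ler_pM ?coord_le_norm.
Qed.

Lemma dot_continuous v : continuous (dot v).
Proof.
rewrite /dot; apply: continuous_big => [|i _ x]; first exact: add_continuous.
by apply: (@continuousM R _ (cst (v ord0 i)) (fun w => w ord0 i) x);
  [exact: cst_continuous|exact: coord_continuous].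
Qed.

End ScalarProduct.

Lemma dot_delta (R : realType) n (v : 'rV[R]_n) i :
  dot v (delta_mx ord0 i) = v ord0 i.
Proof.
rewrite /dot (bigD1 i) //= big1 ?addr0 ?mxE ?eqxx ?mulr1 // => j ji.
by rewrite mxE (negPf ji) andbF mulr0.
Qed.

(** * Differentials through their first-order remainder *)

Section Differential.
Context {R : realType} {V W : normedModType R}.

Lemma differentiable_remainder (f : V -> W) (x : V) (e : R) : 0 < e ->
  differentiable f x ->
  \forall h \near 0, `|f (x + h) - f x - 'd f x h| <= e * `|h|.
Proof.
move=> e0 /diff_locally /eqaddoP /(_ _ e0); apply: filterS => h.
rewrite /= opprD !addrA /cst.
by rewrite -![(_ - _ : V -> W) _]/(_ - _) /= (addrC h).
Qed.

Lemma differentiable_diff_intro (f : V -> W) (x : V) (L : {linear V -> W}) :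
    continuous L ->
    (forall e : R, 0 < e ->
      \forall h \near 0, `|f (x + h) - f x - L h| <= e * `|h|) ->
  is_diff x f L.
Proof.
move=> Lc H.
have E : f \o shift x = cst (f x) + L +o_ 0 id.
  apply/eqaddoP => e e0; apply: filterS (H e e0) => h /=.
  by rewrite opprD !addrA /cst -![(_ - _ : V -> W) _]/(_ - _) /= (addrC h).
have dE := diff_unique Lc E.
by split=> //; apply/diff_locallyP; rewrite dE.
Qed.

(** Serves the second differentiability of the prior, whose gradient is given by an explicit product
    only on the open rectangle. *)
Lemma near_eq_differentiable (f g : V -> W) (x : V) :
  (\forall y \near x, f y = g y) -> differentiable f x -> differentiable g x.
Proof.
move=> fg df; suff: is_diff x g ('d f x) by case.
apply: differentiable_diff_intro.
  exact: diff_continuous df.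
move=> e e0; move: (nbhs_singleton fg) => fgx.
have cx : (fun h => x + h) @ (0 : V) --> x.
  by rewrite -[X in _ --> X]addr0; apply: cvgD; [exact: cvg_cst|exact: cvg_id].
have {}fg : \forall h \near 0, f (x + h) = g (x + h) := cx _ fg.
have := differentiable_remainder e0 df.
by apply: filterS2 fg => h /= <-; rewrite fgx.
Qed.

End Differential.

(** * Integrals of a vector field along segments *)

Section SegmentIntegral.
Context {R : realType} {n : nat}.
Implicit Types (phi : 'rV[R]_n -> 'rV[R]_n) (x y z : 'rV[R]_n).

(** Projection of the line onto [0, 1]. It makes [speed] continuous on all of [R] although [phi] is
    evaluated, and known to be continuous, only on the segment. *)
Definition clamp (s : R) : R := Num.max 0 (Num.min 1 s).

Lemma clamp_id s : 0 <= s <= 1 -> clamp s = s.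
Proof. by move=> /andP[s0 s1]; rewrite /clamp (min_r s1) (max_r s0). Qed.

Lemma clamp_itv s : 0 <= clamp s <= 1.
Proof. by rewrite /clamp le_max lexx ge_max ler01 ge_min lexx. Qed.

Lemma clamp_continuous : continuous clamp.
Proof.
move=> s; apply: (@continuous_max R R (cst 0) (cst 1 \min id)).
  exact: cst_continuous.
by apply: (@continuous_min R R (cst 1) id); [exact: cst_continuous|exact: cvg_id].
Qed.

Definition speed phi x y (s : R) : R :=
  dot (phi (x + clamp s *: (y - x))) (y - x).

(* The integral starts at -1 and the speed is frozen outside [0, 1], so that
   this is differentiable on the whole closed interval [0, 1]. *)
Definition segprim phi x y (s : R) : R :=
  \int[lebesgue_measure]_(t in `[(-1)%R, s]) speed phi x y t.

Definition segint phi x y : R := segprim phi x y 1 - segprim phi x y 0.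

Definition continuous_along phi x y :=
  forall s : R, 0 <= s <= 1 -> {for x + s *: (y - x), continuous phi}.

Lemma speedE phi x y s : 0 <= s <= 1 ->
  speed phi x y s = dot (phi (x + s *: (y - x))) (y - x).
Proof. by move=> s01; rewrite /speed clamp_id. Qed.

Lemma speed_continuous phi x y :
  continuous_along phi x y -> continuous (speed phi x y).
Proof.
move=> phic s.
have -> : speed phi x y =
    dot (y - x) \o (fun s => phi (x + clamp s *: (y - x))).
  by apply/funext => t; rewrite /speed dotC.
apply: continuous_comp; last exact: dot_continuous.
apply: (@continuous_comp _ _ _ (fun s => x + clamp s *: (y - x)) phi).
  apply: cvgD; first exact: cvg_cst.
  apply: cvgZr_tmp; exact: clamp_continuous.
by apply: phic; exact: clamp_itv.
Qed.

Lemma is_derive_segprim phi x y (s : R) : continuous_along phi x y -> 0 <= s <= 1 ->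
  is_derive s 1 (segprim phi x y) (speed phi x y s).
Proof.
move=> phic /andP[s0 s1]; have gc := speed_continuous phic.
(* The fundamental theorem of calculus is applied on [-1, 2], which contains every [s] of [0, 1] in
   its interior, so the derivative is two-sided even at 0 and 1. *)
have [||||? <-] := @continuous_FTC1 R (speed phi x y) (BLeft (-1)) s 2.
- by rewrite (le_lt_trans s1) // ltr1n.
- apply: continuous_compact_integrable; first exact: segment_compact.
  exact: continuous_subspaceT.
- by rewrite lte_fin (lt_le_trans _ s0) // ltrN10.
- exact: gc.
by rewrite derive1E; exact/derivableP.
Qed.

(** The mean value theorem for [segprim phi x y - Q] expresses the left-hand difference as the value
    of [speed phi x y - q] at one point of [0, 1]. Every later estimate of an integral is obtained
    by choosing a comparison function [Q]. *)
Lemma segint_estimate phi x y (Q q : R -> R) (M : R) :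
    continuous_along phi x y ->
    (forall s : R, 0 <= s <= 1 -> is_derive s 1 Q (q s)) ->
    (forall s : R, 0 <= s <= 1 ->
       `|dot (phi (x + s *: (y - x))) (y - x) - q s| <= M) ->
  `|segint phi x y - (Q 1 - Q 0)| <= M.
Proof.
move=> phic dQ HM.
pose D (s : R) := speed phi x y s - q s.
pose H : R -> R := segprim phi x y - Q.
have dH (s : R) : 0 <= s <= 1 -> is_derive s 1 H (D s).
  by move=> s01; apply: is_deriveB; [exact: is_derive_segprim|exact: dQ].
have dHoo (s : R) : s \in `]0, 1[ -> is_derive s 1 H (D s).
  by rewrite in_itv /= => /andP[s0 s1]; apply: dH; rewrite !ltW.
have cH : {within `[0, 1], continuous H}.
  by apply: derivable_within_continuous => s; rewrite in_itv /= => /dH [].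
have [c] := MVT_segment ler01 dHoo cH.
rewrite in_itv /= subr0 mulr1 => c01 E.
have -> : segint phi x y - (Q 1 - Q 0) = D c.
  rewrite -E /H -![(_ - _ : R -> R) _]/(_ - _) /segint opprD !opprK.
  by rewrite addrACA opprD opprK.
by rewrite /D speedE //; apply: HM.
Qed.

Lemma segintE phi x y (Q : R -> R) :
    continuous_along phi x y ->
    (forall s : R, 0 <= s <= 1 ->
       is_derive s 1 Q (dot (phi (x + s *: (y - x))) (y - x))) ->
  segint phi x y = Q 1 - Q 0.
Proof.
move=> phic dQ; apply/eqP; rewrite -subr_eq0 -normr_le0.
by apply: (segint_estimate phic dQ) => s _; rewrite subrr normr0.
Qed.

(** Change of variable: [segprim] composed with [s -> a + s (b - a)] is a primitive along the
    subsegment. The parameters [a] and [b] come in any order, so this yields both reversal and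
    bisection of a segment. *)
Lemma segint_sub phi x y (a b : R) : continuous_along phi x y ->
    0 <= a <= 1 -> 0 <= b <= 1 ->
  segint phi (x + a *: (y - x)) (x + b *: (y - x)) =
  segprim phi x y b - segprim phi x y a.
Proof.
move=> phic a01 b01.
have dE : x + b *: (y - x) - (x + a *: (y - x)) = (b - a) *: (y - x).
  by rewrite scalerBl opprD addrACA subrr add0r.
have pE (s : R) : x + a *: (y - x) + s *: ((b - a) *: (y - x)) =
            x + (a + s * (b - a)) *: (y - x).
  by rewrite scalerA -addrA -scalerDl.
have sab (s : R) : 0 <= s <= 1 -> 0 <= a + s * (b - a) <= 1.
  move: a01 b01 => /andP[? ?] /andP[? ?] /andP[? ?]; apply/andP; split; nra.
have H := @segintE phi (x + a *: (y - x)) (x + b *: (y - x))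
  (segprim phi x y \o (fun s => a + s * (b - a))).
apply: (etrans (H _ _)); last by rewrite /= mul1r mul0r addr0 subrKC.
  by move=> s s01; rewrite dE pE; apply: phic; exact: sab.
move=> s s01; rewrite dE pE linearZ /= -speedE ?sab//.
rewrite [_ *: _](mulrC (b - a)).
apply: is_derive1_comp; first by apply: is_derive_segprim => //; exact: sab.
apply: is_derive_eq.
by rewrite add0r mul1r scaler0 add0r /GRing.scale /= mulr1.
Qed.

Lemma segintC phi x y : continuous_along phi x y ->
  segint phi y x = - segint phi x y.
Proof.
move=> phic; have := @segint_sub phi x y 1 0 phic.
by rewrite scale1r scale0r addr0 subrKC !lexx ler01 /segint opprB; apply.
Qed.

Definition midpoint x y := x + 2^-1 *: (y - x).

Lemma segint_midpoint phi x y : continuous_along phi x y ->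
  segint phi x y = segint phi x (midpoint x y) + segint phi (midpoint x y) y.
Proof.
move=> phic.
have h01 : 0 <= (2^-1 : R) <= 1 by apply/andP; split; lra.
have o01 : 0 <= (0 : R) <= 1 by rewrite lexx ler01.
have i01 : 0 <= (1 : R) <= 1 by rewrite lexx ler01.
have := segint_sub phic o01 h01; have := segint_sub phic h01 i01.
rewrite scale1r scale0r addr0 subrKC -/(midpoint x y) => -> ->.
by rewrite /segint; ring.
Qed.

End SegmentIntegral.

(** * Circulation around small triangles *)

Section Circulation.
Context {R : realType} {n : nat}.
Implicit Types (phi : 'rV[R]_n -> 'rV[R]_n) (x y z p : 'rV[R]_n).
Implicit Type K : set 'rV[R]_n.

Definition circulation phi x y z : R :=
  segint phi x y + segint phi y z + segint phi z x.

Definition segment_closed K :=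
  forall x y (s : R), K x -> K y -> 0 <= s <= 1 -> K (x + s *: (y - x)).

Lemma segment_closed_along K phi x y : segment_closed K ->
  (forall z, K z -> {for z, continuous phi}) -> K x -> K y ->
  continuous_along phi x y.
Proof. by move=> Kc phic Kx Ky s s01; apply: phic; exact: Kc. Qed.

(** Along the segment, [phi] is its first-order Taylor polynomial at [p] plus a remainder of norm at
    most [e * d]. The polynomial integrates to the explicit quadratic expression; the factor [n]
    comes from [dot_le_norm]. *)
Lemma segint_local K phi p (e : R) : segment_closed K ->
    (forall z, K z -> {for z, continuous phi}) ->
    differentiable phi p -> 0 < e ->
  exists2 r : R, 0 < r & forall (d : R) x y, d < r -> K x -> K y ->
    `|x - p| <= d -> `|y - p| <= d ->
    `|segint phi x y - (dot (phi p) (y - x) + dot ('d phi p (x - p)) (y - x)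
       + 2^-1 * dot ('d phi p (y - x)) (y - x))|
    <= n%:R * (e * d * `|y - x|).
Proof.
move=> Kc phic dphi e0.
have /nbhs_ballP[r /= r0 Hr] := differentiable_remainder e0 dphi.
exists r => // d x y dr Kx Ky xd yd.
set v := y - x; set A := dot (phi p) v; set B1 := dot _ v; set B2 := dot _ v.
(* A primitive of [A + B1 + s * B2], which is the Taylor polynomial at [x + s *: v] paired with
   [v]. *)
pose Q (s : R) := s * (A + B1) + s * s * (2^-1 * B2).
have QE : A + B1 + 2^-1 * B2 = Q 1 - Q 0 by rewrite /Q; ring.
rewrite QE.
apply: (@segint_estimate _ _ _ _ _ Q (fun s => A + B1 + s * B2)).
- exact: (segment_closed_along Kc).
- move=> s _; apply: is_derive_eq.
  by rewrite /GRing.scale /=; field.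
move=> s /andP[s0 s1]; rewrite -/v.
pose w := x + s *: v - p.
(* As a convex combination of [x - p] and [y - p], the displacement [w] also has norm at most
   [d]. *)
have wE : w = (1 - s) *: (x - p) + s *: (y - p).
  by apply/rowP => i; rewrite /w /v !mxE; ring.
have wd : `|w| <= d.
  rewrite wE (le_trans (ler_normD _ _)) // !normrZ.
  rewrite (ger0_norm s0) ger0_norm ?subr_ge0 //.
  by nra.
have -> : dot (phi (x + s *: v)) v - (A + B1 + s * B2) =
    dot (phi (p + w) - phi p - 'd phi p w) v.
  have -> : p + w = x + s *: v by rewrite /w addrC subrK.
  have -> : w = s *: v + (x - p) by rewrite /w addrAC addrC.
  rewrite !dotBl linearP /= dotDl dotZl.
  by rewrite -/A -/B1 -/B2; ring.
apply: (le_trans (dot_le_norm _ _)); apply: ler_wpM2l => //.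
apply: ler_wpM2r => //; apply: (le_trans (Hr w _)).
  by rewrite -ball_normE /= sub0r normrN (le_lt_trans wd).
by rewrite ler_wpM2l // ltW.
Qed.

(** Exact circulation of the affine field [c + L] around the triangle [a], [a + v], [a + w]:
    everything cancels except the antisymmetric part of [L]. *)
Lemma affine_circulation (c : 'rV[R]_n) (L : {linear 'rV[R]_n -> 'rV[R]_n})
    (a v w : 'rV[R]_n) :
  (dot c v + dot (L a) v + 2^-1 * dot (L v) v)
  + (dot c (w - v) + dot (L (a + v)) (w - v) + 2^-1 * dot (L (w - v)) (w - v))
  + (dot c (- w) + dot (L (a + w)) (- w) + 2^-1 * dot (L (- w)) (- w))
  = 2^-1 * (dot (L v) w - dot (L w) v).
Proof.
by rewrite !linearD !linearN /= !dotDl !dotNl; field.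
Qed.

Lemma circulation_local K phi p (e : R) : segment_closed K ->
    (forall z, K z -> {for z, continuous phi}) ->
    differentiable phi p -> 0 < e ->
  exists2 r : R, 0 < r & forall (d : R) x y z, d < r -> K x -> K y -> K z ->
    `|x - p| <= d -> `|y - p| <= d -> `|z - p| <= d ->
    `|circulation phi x y z - 2^-1 * (dot ('d phi p (y - x)) (z - x)
       - dot ('d phi p (z - x)) (y - x))|
    <= n%:R * (e * d * (`|y - x| + `|z - y| + `|x - z|)).
Proof.
move=> Kc phic dphi e0.
have [r r0 Hr] := segint_local Kc phic dphi e0.
exists r => // d x y z dr Kx Ky Kz xd yd zd.
have := Hr d x y dr Kx Ky xd yd; have := Hr d y z dr Ky Kz yd zd.
have := Hr d z x dr Kz Kx zd xd.
set v := y - x; set w := z - x; set a := x - p.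
have -> : x - z = - w by rewrite opprB.
have -> : z - y = w - v by rewrite opprB addrA subrK.
have -> : y - p = a + v by rewrite /a /v [RHS]addrC addrA subrK.
have -> : z - p = a + w by rewrite /a /w [RHS]addrC addrA subrK.
rewrite -(affine_circulation (phi p) ('d phi p) a v w).
rewrite /circulation.
set I1 := segint phi x y; set I2 := segint phi y z; set I3 := segint phi z x.
rewrite !ler_norml => /andP[? ?] /andP[? ?] /andP[? ?].
by rewrite !mulrDr; apply/andP; split; lra.
Qed.

End Circulation.

(** * Sequences with geometrically decreasing steps *)

Section Sequences.
Context {R : realType}.

Lemma small_halving (c e : R) : 0 < e -> exists k, c / 2 ^+ k < e.
Proof.
move=> e0.
have half1 : `|2^-1 : R| < 1 by rewrite ger0_norm; lra.
have [k _ Hk] := cvgr_lt _ (cvg_geometric c half1) e e0.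
by exists k; have := Hk k (leqnn k); rewrite /geometric /= exprVn.
Qed.

Lemma le0_of_le_eps (x C : R) : (forall e, 0 < e -> x <= e * C) -> x <= 0.
Proof.
move=> H; rewrite leNgt; apply/negP => x0.
have C1 : 0 < `|C| + 1 by rewrite ltr_wpDl.
(* For this [e] the product [e * C] is at most [x / 2], and the added 1 keeps the denominator
   positive when [C] is 0. *)
have e0 : 0 < x / (2 * (`|C| + 1)) by rewrite divr_gt0 // mulr_gt0.
have := le_trans (H _ e0) (ler_wpM2l (ltW e0) (ler_norm C)).
rewrite mulrAC ler_pdivlMr ?mulr_gt0 //; have := normr_ge0 C; nra.
Qed.

(** The tails are dominated by a geometric series, so the sequence is Cauchy; the bound passes to
    the limit because closed balls are closed. *)
Lemma halving_sequence_cvg n (u : nat -> 'rV[R]_n) (c : R) :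
    (forall k, `|u k.+1 - u k| <= c / 2 ^+ k) ->
  exists2 l : 'rV[R]_n, u @ \oo --> l & forall k, `|u k - l| <= 2 * (c / 2 ^+ k).
Proof.
move=> Hu.
(* The subtracted term is the part of the geometric series not yet used; it makes the induction on
   [m] close. *)
have tail k m : `|u k - u (k + m)%N| <= 2 * (c / 2 ^+ k) - 2 * (c / 2 ^+ (k + m)).
  elim: m => [|m IH]; first by rewrite addn0 !subrr normr0.
  have E : c / 2 ^+ (k + m).+1 = c / 2 ^+ (k + m) / 2.
    by rewrite exprS invfM mulrCA mulrC.
  rewrite addnS E.
  have := ler_distD (u (k + m)%N) (u k) (u (k + m).+1).
  have := Hu (k + m)%N; rewrite (distrC (u _.+1)); lra.
have c0 : 0 <= c by have := le_trans (normr_ge0 _) (Hu 0%N); rewrite expr0 divr1.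
have tail' k m : (k <= m)%N -> `|u k - u m| <= 2 * (c / 2 ^+ k).
  move=> /subnKC <-; apply: (le_trans (tail _ _)).
  by rewrite gerBl mulr_ge0 // divr_ge0 // exprn_ge0.
have : cvg (u @ \oo).
  apply: cauchy_cvg; apply: cauchy_exP => e e0.
  have [k Hk] := small_halving (2 * c) e0.
  exists (u k); exists k => // m /= km.
  rewrite -ball_normE /=; apply: le_lt_trans Hk.
  by rewrite -mulrA; exact: tail'.
move=> /cvg_ex[l ul]; exists l => // k.
apply: (@closed_cvg _ _ _ _ u
  (closed_ball_ Num.norm (u k) (2 * (c / 2 ^+ k)))) ul.
  exact: closed_closed_ball_.
by exists k => // m /= km; exact: tail'.
Qed.

End Sequences.

(** * Goursat's bisection argument *)

Section Goursat.
Context {R : realType} {n : nat}.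
Implicit Types (phi : 'rV[R]_n -> 'rV[R]_n) (x y z p : 'rV[R]_n).
Implicit Type K : set 'rV[R]_n.

Definition perimeter x y z : R := `|y - x| + `|z - y| + `|x - z|.

Lemma norm_half x y : x = 2^-1 *: y -> `|x| = `|y| / 2.
Proof. by move=> ->; rewrite normrZ ger0_norm // mulrC. Qed.

Lemma norm_half_le x y : x = 2^-1 *: y -> `|x| <= `|y|.
Proof. by move=> /norm_half ->; have := normr_ge0 y; lra. Qed.

Lemma ler_norm_sum4 (a b c d : R) (s := a + b + c + d) :
  [\/ `|s| <= 4 * `|a|, `|s| <= 4 * `|b|, `|s| <= 4 * `|c| | `|s| <= 4 * `|d| ].
Proof.
have H : `|s| <= `|a| + `|b| + `|c| + `|d|.
  by apply: (le_trans (ler_normD _ _)); rewrite lerD2r;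
    apply: (le_trans (ler_normD _ _)); rewrite lerD2r ler_normD.
have [?|h1] := leP `|s| (4 * `|a|); first by constructor 1.
have [?|h2] := leP `|s| (4 * `|b|); first by constructor 2.
have [?|h3] := leP `|s| (4 * `|c|); first by constructor 3.
by constructor 4; lra.
Qed.

Lemma midpoint_closed K x y : segment_closed K -> K x -> K y -> K (midpoint x y).
Proof. by move=> Kc Kx Ky; apply: Kc => //; apply/andP; split; lra. Qed.

(** The midpoints cut the triangle into four. Inner edges are run through once in each direction and
    cancel, so the four circulations add up to the original one and some piece carries at least a
    quarter of it. The bound on [x' - x] makes the first vertices of iterated pieces converge. *)
Lemma circulation_bisect K phi x y z : segment_closed K ->
    (forall w, K w -> {for w, continuous phi}) -> K x -> K y -> K z ->
  exists x' y' z', [/\ [/\ K x', K y' & K z'],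
    `|circulation phi x y z| <= 4 * `|circulation phi x' y' z'|,
    perimeter x' y' z' = perimeter x y z / 2 &
    `|x' - x| <= perimeter x y z].
Proof.
move=> Kc phic Kx Ky Kz.
pose a := midpoint x y; pose b := midpoint y z; pose c := midpoint z x.
have Ka : K a by exact: midpoint_closed.
have Kb : K b by exact: midpoint_closed.
have Kd : K c by exact: midpoint_closed.
have along := fun u v Ku Kv => @segment_closed_along _ _ K phi u v Kc phic Ku Kv.
have E : circulation phi x y z = circulation phi x a c + circulation phi a y b
    + circulation phi c b z + circulation phi a b c.
  rewrite /circulation (segint_midpoint (along x y Kx Ky)).
  rewrite (segint_midpoint (along y z Ky Kz)) (segint_midpoint (along z x Kz Kx)).
  rewrite (segintC (along b a Kb Ka)) (segintC (along c b Kd Kb)).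
  rewrite (segintC (along a c Ka Kd)) -/a -/b -/c.
  move: (segint phi x a) (segint phi a y) (segint phi y b) (segint phi b z)
    (segint phi z c) (segint phi c x) (segint phi a c) (segint phi b a)
    (segint phi c b) => *; ring.
have lexy : `|y - x| <= perimeter x y z.
  by rewrite /perimeter -addrA lerDl addr_ge0.
have lexz : `|x - z| <= perimeter x y z.
  by rewrite /perimeter lerDr addr_ge0.
have := ler_norm_sum4 (circulation phi x a c) (circulation phi a y b)
  (circulation phi c b z) (circulation phi a b c).
rewrite -E => four.
have ax : `|a - x| <= perimeter x y z.
  by apply: le_trans lexy; apply: norm_half_le; rewrite /a /midpoint addrC addKr.
have cx : `|c - x| <= perimeter x y z.
  apply: le_trans lexz; rewrite distrC; apply: norm_half_le.
  by apply/rowP => i; rewrite /c !mxE; field.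
have xx : `|x - x| <= perimeter x y z.
  by rewrite subrr normr0 /perimeter !addr_ge0.
have half (u v w u' v' w' : 'rV[R]_n) :
    v - u = 2^-1 *: v' -> w - v = 2^-1 *: w' -> u - w = 2^-1 *: u' ->
    `|v'| + `|w'| + `|u'| = perimeter x y z -> perimeter u v w = perimeter x y z / 2.
  move=> /norm_half vE /norm_half wE /norm_half uE <-.
  by rewrite /perimeter vE wE uE -!mulrDl.
case: four => H.
- exists x, a, c; split => //.
  apply: (half _ _ _ (x - z) (y - x) (z - y)); rewrite /perimeter //;
    by apply/rowP => i; rewrite /a /b /c /midpoint !mxE; field.
- exists a, y, b; split => //.
  apply: (half _ _ _ (x - z) (y - x) (z - y)); rewrite /perimeter //;
    by apply/rowP => i; rewrite /a /b /c /midpoint !mxE; field.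
- exists c, b, z; split => //.
  apply: (half _ _ _ (x - z) (y - x) (z - y)); rewrite /perimeter //;
    by apply/rowP => i; rewrite /a /b /c /midpoint !mxE; field.
- exists a, b, c; split => //.
  apply: (half _ _ _ (y - z) (z - x) (x - y)).
  + by apply/rowP => i; rewrite /a /b /c /midpoint !mxE; field.
  + by apply/rowP => i; rewrite /a /b /c /midpoint !mxE; field.
  + by apply/rowP => i; rewrite /a /b /c /midpoint !mxE; field.
  by rewrite /perimeter (distrC z x) (distrC x y) (distrC y z); ring.
Qed.

(** Coordinate-free form of the cross-derivative condition; see [diff_symmetricP]. *)
Definition diff_symmetric phi p :=
  forall v w, dot ('d phi p v) w = dot ('d phi p w) v.

(** After [k] bisections the circulation has lost at most a factor [4 ^+ k], while the squared
    perimeter has lost exactly that factor. At the limit point [p] symmetry makes the circulation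
    small compared with the squared perimeter, so it must vanish. *)
Lemma goursat K phi x y z : closed K -> segment_closed K ->
    (forall p, K p -> differentiable phi p) ->
    (forall p, K p -> diff_symmetric phi p) ->
  K x -> K y -> K z -> circulation phi x y z = 0.
Proof.
move=> Kcl Kc dphi sphi Kx Ky Kz.
have phic p (Kp : K p) : {for p, continuous phi}.
  exact: differentiable_continuous (dphi p Kp).
pose circ (t : 'rV[R]_n * 'rV[R]_n * 'rV[R]_n) :=
  `|circulation phi t.1.1 t.1.2 t.2|.
pose per (t : 'rV[R]_n * 'rV[R]_n * 'rV[R]_n) := perimeter t.1.1 t.1.2 t.2.
pose inK (t : 'rV[R]_n * 'rV[R]_n * 'rV[R]_n) := [/\ K t.1.1, K t.1.2 & K t.2].
(* The membership condition stands inside the existential so that [choice] yields a total function,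
   which can be iterated; triples outside [K] get themselves as default. *)
have /choice[f Hf] : forall t, exists t', inK t ->
    [/\ inK t', circ t <= 4 * circ t', per t' = per t / 2 &
        `|t'.1.1 - t.1.1| <= per t].
  move=> [[x0 y0] z0]; have [[/= Kx0 Ky0 Kz0]|nK] := pselect (inK (x0, y0, z0)).
    have [x1 [y1 [z1 H]]] := circulation_bisect Kc phic Kx0 Ky0 Kz0.
    by exists (x1, y1, z1).
  by exists (x0, y0, z0).
pose u k := iter k f (x, y, z).
have uK k : inK (u k) by elim: k => // k /Hf[].
have uper k : per (u k) = perimeter x y z / 2 ^+ k.
  elim: k => [|k IH]; first by rewrite expr0 divr1.
  by have [_ _ /= -> _] := Hf _ (uK k); rewrite IH exprS invfM mulrCA mulrC.
have ucirc k : `|circulation phi x y z| <= 4 ^+ k * circ (u k).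
  elim: k => [|k IH]; first by rewrite expr0 mul1r.
  apply: (le_trans IH); rewrite exprSr -mulrA ler_wpM2l ?exprn_ge0 //.
  by have [] := Hf _ (uK k).
(* Consecutive first vertices are no further apart than the current perimeter, which halves at each
   step. *)
have [|p up Hp] := @halving_sequence_cvg R n (fun k => (u k).1.1) (perimeter x y z).
  by move=> k; rewrite -uper; have [] := Hf _ (uK k).
have Kp : K p.
  apply: (@closed_cvg _ _ _ _ (fun k => (u k).1.1) K) up => //.
  by apply: nearW => k; have [] := uK k.
apply/eqP; rewrite -normr_le0.
(* The 3 arises because the first vertex is within two perimeters of [p], hence all vertices are
   within three. *)
apply: (@le0_of_le_eps R _ (3 * n%:R * perimeter x y z ^+ 2)) => e e0.
have [r r0 Hr] := circulation_local Kc phic (dphi p Kp) e0.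
have [k Hk] := small_halving (3 * perimeter x y z) r0.
apply: (le_trans (ucirc k)).
have [xK yK zK] := uK k.
have := Hp k; have := Hr _ _ _ _ Hk xK yK zK.
have := uper k; rewrite /circ /per.
case: (u k) xK yK zK => [[x' y'] z'] /= _ _ _ E H xp.
(* Symmetry of the differential at [p] removes the second-order term, leaving only the error. *)
move: H; rewrite sphi // subrr mulr0 subr0 -mulrA -E.
move: xp; rewrite -E => xp.
have dxy : `|y' - x'| <= perimeter x' y' z'.
  by rewrite /perimeter -addrA lerDl addr_ge0.
have dxz : `|z' - x'| <= perimeter x' y' z'.
  by rewrite distrC /perimeter lerDr addr_ge0.
have per0 : 0 <= perimeter x' y' z' by apply: le_trans dxy.
move=> H.
have {}H : `|circulation phi x' y' z'| <=
    n%:R * (e * (3 * perimeter x' y' z') * perimeter x' y' z').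
  apply: H.
  - by apply: (le_trans xp); nra.
  - apply: (le_trans (ler_distD x' _ _)); lra.
  - apply: (le_trans (ler_distD x' _ _)); lra.
apply: (le_trans (ler_wpM2l _ H)); first exact: exprn_ge0.
have -> : perimeter x y z = perimeter x' y' z' * 2 ^+ k by rewrite E divfK.
rewrite exprMn -exprM mulnC exprM (_ : 2 ^+ 2 = 4); last by ring.
by rewrite le_eqVlt; apply/orP; left; apply/eqP; ring.
Qed.

End Goursat.

(** * Potentials and vanishing circulation *)

Section Potential.
Context {R : realType} {n : nat}.
Implicit Types (phi : 'rV[R]_n -> 'rV[R]_n) (x y z p : 'rV[R]_n).
Implicit Type K : set 'rV[R]_n.

(** The difference quotient along the line is the directional difference quotient of [F]. *)
Lemma is_derive_line (F : 'rV[R]_n -> R) (L : {linear 'rV[R]_n -> R}) x v (s : R) :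
  is_diff (x + s *: v) F L ->
  is_derive s 1 (fun t : R => F (x + t *: v)) (L v).
Proof.
move=> dF.
have E : (fun h : R => h^-1 *: (((fun t : R => F (x + t *: v)) \o shift s) (h *: 1)
      - F (x + s *: v))) =
    (fun h : R => h^-1 *: ((F \o shift (x + s *: v)) (h *: v) - F (x + s *: v))).
  apply/funext => h /=; congr (_ *: (F _ - _)).
  by rewrite [h *: 1]mulr1 scalerDl addrCA.
have dFp := @ex_diff _ _ _ _ _ _ _ dF.
split; first by rewrite /derivable E; exact: diff_derivable dFp.
rewrite /derive E -/(derive F _ _) deriveE //.
by rewrite (@diff_val _ _ _ _ _ _ _ dF).
Qed.

Lemma circulation_of_potential K phi (F : 'rV[R]_n -> R) x y z :
    segment_closed K ->
    (forall w, K w -> {for w, continuous phi}) ->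
    (forall w, K w -> is_diff w F (dot (phi w))) ->
  K x -> K y -> K z -> circulation phi x y z = 0.
Proof.
move=> Kc phic dF Kx Ky Kz.
have S u v : K u -> K v -> segint phi u v = F v - F u.
  move=> Ku Kv.
  have H := @segintE _ _ phi u v (fun s => F (u + s *: (v - u))).
  apply: (etrans (H _ _)); last by rewrite scale1r scale0r addr0 subrKC.
    exact: (segment_closed_along Kc).
  by move=> s s01; apply: is_derive_line; apply: dF; exact: Kc.
by rewrite /circulation !S //; ring.
Qed.

(** In the triangle [p], [p + h *: v], [p + h *: w] both the antisymmetric term and the error bound
    scale like [h ^+ 2]. Dividing by it leaves a bound proportional to an arbitrary [e]. *)
Lemma diff_symmetric_of_circulation K phi p : open K -> segment_closed K ->
    (forall w, K w -> differentiable phi w) ->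
    (forall x y z, K x -> K y -> K z -> circulation phi x y z = 0) ->
  K p -> diff_symmetric phi p.
Proof.
move=> Ko Kc dphi circ0 Kp v w.
have phic q (Kq : K q) : {for q, continuous phi}.
  exact: differentiable_continuous (dphi q Kq).
apply/eqP; rewrite -subr_eq0 -normr_le0.
pose m := `|v| + `|w|; have m0 : 0 <= m by rewrite addr_ge0.
(* The distance bound is [h * m], the perimeter is at most [h * (m + |w - v|)], and the 2 undoes the
   factor [2^-1] of [circulation_local]. *)
apply: (@le0_of_le_eps R _ (2 * n%:R * m * (m + `|w - v|))) => e e0.
have [r r0 Hr] := circulation_local Kc phic (dphi p Kp) e0.
have /nbhs_ballP[r' /= r'0 Kr'] : nbhs p K by exact: open_nbhs_nbhs.
have [h h0 [hr hr']] : exists2 h, 0 < h & h * m < r /\ h * m < r'.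
  have m1 : 0 < 2 * (m + 1) by lra.
  pose h := Num.min r r' / (2 * (m + 1)).
  have h0 : 0 < h by rewrite divr_gt0 // lt_min r0.
  exists h => //; apply/andP; rewrite -lt_min.
  have : h * (2 * (m + 1)) = Num.min r r' by rewrite divfK // gt_eqF.
  by nra.
have Kh u : `|u| <= m -> K (p + h *: u).
  move=> um; apply: Kr'; rewrite -ball_normE /= opprD addrA subrr sub0r normrN.
  by rewrite normrZ gtr0_norm //; nra.
have vm : `|v| <= m by rewrite lerDl.
have wm : `|w| <= m by rewrite lerDr.
have pE u : p + h *: u - p = h *: u by rewrite addrC addKr.
have LZ u : 'd phi p (h *: u) = h *: 'd phi p u by rewrite linearZ.
have := Hr _ p (p + h *: v) (p + h *: w) hr Kp (Kh v vm) (Kh w wm).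
rewrite circ0 //; [rewrite sub0r normrN|exact: Kh|exact: Kh].
rewrite !pE subrr normr0 !LZ !dotZl !dotZr.
set B := dot _ w; set B' := dot _ v.
have -> : 2^-1 * (h * (h * B) - h * (h * B')) = h ^+ 2 * (2^-1 * (B - B')) by ring.
have h2 : 0 < h ^+ 2 by rewrite exprn_gt0.
rewrite (normrM (h ^+ 2)) (gtr0_norm h2) (normrM 2^-1) [`|2^-1|]ger0_norm //.
set N := `|B - B'|.
have -> : p + h *: w - (p + h *: v) = h *: (w - v).
  by apply/rowP => i; rewrite !mxE; ring.
have -> : p - (p + h *: w) = h *: - w.
  by apply/rowP => i; rewrite !mxE; ring.
rewrite !normrZ normrN (gtr0_norm h0).
move=> H.
have {}H := H (mulr_ge0 (ltW h0) m0) (ler_wpM2l (ltW h0) vm) (ler_wpM2l (ltW h0) wm).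
rewrite -(ler_pM2l h2).
have -> : h ^+ 2 * N = 2 * (h ^+ 2 * (2^-1 * N)) by field.
have -> : h ^+ 2 * (e * (2 * n%:R * m * (m + `|w - v|))) =
  2 * (n%:R * (e * (h * m) * (h * `|v| + h * `|w - v| + h * `|w|))).
  by rewrite /m; ring.
by rewrite ler_pM2l.
Qed.

(** Zero circulation around [c], [p], [p + h] turns the increment of the potential into the integral
    from [p] to [p + h], where continuity keeps [phi] close to [phi p]. *)
Lemma is_diff_potential K phi c p : open K -> segment_closed K ->
    (forall w, K w -> {for w, continuous phi}) ->
    (forall x y z, K x -> K y -> K z -> circulation phi x y z = 0) ->
  K c -> K p -> is_diff p (segint phi c) (dot (phi p)).
Proof.
move=> Ko Kc phic circ0 Kbase Kp.
have along u v : K u -> K v -> continuous_along phi u v.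
  exact: (segment_closed_along Kc).
apply: differentiable_diff_intro; first exact: dot_continuous.
move=> e e0.
(* The denominator absorbs the factor [n] of [dot_le_norm]; the 1 covers [n = 0]. *)
have e1 : 0 < e / (n%:R + 1) by rewrite divr_gt0 // ltr_wpDl.
have /nbhs_ballP[r /= r0 Hr] :
    \forall w \near p, `|phi p - phi w| <= e / (n%:R + 1).
  exact: (cvgr_dist_le _ _ (phic p Kp) _ e1).
have /nbhs_ballP[r' /= r'0 Kr'] : nbhs p K by exact: open_nbhs_nbhs.
apply/nbhs_ballP; exists (Num.min r r') => /=; first by rewrite lt_min r0.
move=> h; rewrite -ball_normE /= sub0r normrN lt_min => /andP[hr hr'].
have Kph : K (p + h).
  by apply: Kr'; rewrite -ball_normE /= opprD addrA subrr sub0r normrN.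
have -> : segint phi c (p + h) - segint phi c p = segint phi p (p + h).
  have := circ0 _ _ _ Kbase Kp Kph; rewrite /circulation.
  rewrite (segintC (along _ _ Kbase Kph)) => E.
  by apply/eqP; rewrite eq_sym -subr_eq0 -E; apply/eqP; ring.
(* Puts the linear term into the form [Q 1 - Q 0] with [Q s = s * dot (phi p) h]. *)
have -> : dot (phi p) h = 1 * dot (phi p) h - 0 * dot (phi p) h.
  by rewrite mul1r mul0r subr0.
apply: (@segint_estimate _ _ _ _ _ (fun s => s * dot (phi p) h)
  (fun=> dot (phi p) h)); first exact: along.
  by move=> s _; apply: is_derive_eq; rewrite /GRing.scale /=; ring.
move=> s /andP[s0 s1]; rewrite (addrC p h) addrK -dotBl.
apply: (le_trans (dot_le_norm _ _)).
have Hs : `|phi (p + s *: h) - phi p| <= e / (n%:R + 1).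
  rewrite distrC; apply: Hr; rewrite -ball_normE /= opprD addrA subrr sub0r normrN.
  by rewrite normrZ ger0_norm // (le_lt_trans _ hr) // ler_piMl.
have h0 := normr_ge0 h.
rewrite mulrA ler_wpM2r // (le_trans (ler_wpM2l _ Hs)) //.
by rewrite mulrCA ler_piMr ?(ltW e0) // ler_pdivrMr ?mul1r ?lerDl // ltr_wpDl.
Qed.

End Potential.

(** * Open rectangles and closed boxes *)

Section Rectangle.
Context {R : realType} {p : nat}.
Implicit Types (a b : 'I_p -> \bar R) (x y z : 'rV[R]_p).

Lemma rectangle_open a b : open (rectangle a b).
Proof.
rewrite openE => x abx.
have abi i : nbhs x [set y : 'rV[R]_p | (a i < (y ord0 i)%:E < b i)%E].
  have /andP[ax xb] := abx i.
  have nab : nbhs (x ord0 i) [set t : R | (a i < t%:E < b i)%E].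
    have -> : [set t : R | (a i < t%:E < b i)%E] =
        [set t | (a i < t%:E)%E] `&` [set t | (t%:E < b i)%E].
      by apply/seteqP; split => [t /andP[]|t [? ?]] //; apply/andP.
    apply: open_nbhs_nbhs; split => //.
    by apply: openI; [exact: open_ereal_gt|exact: open_ereal_lt].
  exact: (@coord_continuous R 1 p ord0 i x _ nab).
exact: filter_forall abi.
Qed.

Definition box (l h : 'I_p -> R) : set 'rV[R]_p :=
  [set x | forall i, l i <= x ord0 i <= h i].

Lemma box_closed l h : closed (box l h).
Proof.
have -> : box l h = \bigcap_(i in setT)
    ((fun x : 'rV[R]_p => x ord0 i) @^-1` [set t | l i <= t <= h i]).
  by apply/seteqP; split => [x lh i _|x lh i]; [exact: lh|exact: (lh i I)].
apply: closed_bigI => i _; apply: closed_comp => [x _|].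
  exact: coord_continuous.
have -> : [set t | l i <= t <= h i] = [set t | l i <= t] `&` [set t | t <= h i].
  by apply/seteqP; split => [t /andP[]|t [? ?]] //; apply/andP.
by apply: closedI; [exact: closed_ge|exact: closed_le].
Qed.

Lemma box_segment_closed l h : segment_closed (box l h).
Proof.
move=> x y s lx ly /andP[s0 s1] i; rewrite !mxE.
by have /andP[? ?] := lx i; have /andP[? ?] := ly i; apply/andP; split; nra.
Qed.

(** [goursat] takes limits in a closed set, whereas the rectangle is open. The coordinatewise minima
    and maxima of the three points bound a closed box that stays inside it. *)
Lemma rectangle_box a b x y z : rectangle a b x -> rectangle a b y ->
    rectangle a b z ->
  exists l h, [/\ box l h `<=` rectangle a b, box l h x, box l h y & box l h z].
Proof.
move=> abx aby abz.
exists (fun i => Num.min (x ord0 i) (Num.min (y ord0 i) (z ord0 i))).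
exists (fun i => Num.max (x ord0 i) (Num.max (y ord0 i) (z ord0 i))).
split.
- move=> w lw i; have /andP[lw1 lw2] := lw i.
  have /andP[? ?] := abx i; have /andP[? ?] := aby i; have /andP[? ?] := abz i.
  apply/andP; split.
    apply: (@lt_le_trans _ _ (Num.min (x ord0 i)
      (Num.min (y ord0 i) (z ord0 i)))%:E); last by rewrite lee_fin.
    by rewrite /Num.min; case: ifP => _ //; case: ifP.
  apply: (@le_lt_trans _ _ (Num.max (x ord0 i)
    (Num.max (y ord0 i) (z ord0 i)))%:E); first by rewrite lee_fin.
  by rewrite /Num.max; case: ifP => _ //; case: ifP.
- by move=> i; rewrite ge_min le_max lexx.
- by move=> i; rewrite !ge_min !le_max lexx !orbT.
- by move=> i; rewrite !ge_min !le_max lexx !orbT.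
Qed.

Lemma rectangle_segment_closed a b : segment_closed (rectangle a b).
Proof.
move=> x y s abx aby s01.
have [l [h [lh lx ly _]]] := rectangle_box abx aby aby.
by apply: lh; exact: box_segment_closed.
Qed.

End Rectangle.

(** * Gradients, partial derivatives and the exponential *)

Section Gradient.
Context {R : realType} {p : nat}.
Implicit Types (f : 'rV[R]_p -> R) (phi : 'rV[R]_p -> 'rV[R]_p) (x v : 'rV[R]_p).

Lemma partial_component phi x t u : differentiable phi x ->
  partial u (component phi t) x =
  dot ('d phi x (delta_mx ord0 u)) (delta_mx ord0 t).
Proof.
move=> dphi; rewrite dot_delta -deriveE // derive_mx ?mxE //.
exact: diff_derivable.
Qed.

(** Both sides of the symmetry are bilinear in [v] and [w], so basis vectors suffice, and there the
    values are the partial derivatives. *)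
Lemma diff_symmetricP phi x : differentiable phi x ->
  diff_symmetric phi x <->
  forall t u, partial u (component phi t) x = partial t (component phi u) x.
Proof.
move=> dphi; split=> [sym t u|sym v w]; first by rewrite !partial_component.
have sym_delta t : dot ('d phi x v) (delta_mx ord0 t) =
    dot ('d phi x (delta_mx ord0 t)) v.
  rewrite [v]row_sum_delta !linear_sum dotC linear_sum.
  apply: eq_bigr => u _; rewrite !linearZ /= dotC; congr (_ * _).
  by have := sym t u; rewrite !partial_component.
rewrite [w]row_sum_delta !linear_sum [RHS]dotC linear_sum.
by apply: eq_bigr => t _; rewrite !linearZ /= sym_delta dotC.
Qed.

Lemma diff_gradient f x : differentiable f x ->
  is_diff x f (dot (gradient f x)).
Proof.
move=> df; split=> //; apply/funext => v.
rewrite {1}[v]row_sum_delta linear_sum /dot.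
by apply: eq_bigr => i _; rewrite linearZ mxE /partial deriveE // mulrC.
Qed.

Lemma gradient_diff f x g : is_diff x f (dot g) -> gradient f x = g.
Proof.
move=> df; have dfx := @ex_diff _ _ _ _ _ _ _ df.
apply/rowP => i; rewrite mxE /partial deriveE //.
by rewrite (@diff_val _ _ _ _ _ _ _ df) dot_delta.
Qed.

Lemma differentiable_scale (k : 'rV[R]_p -> R) phi x :
  differentiable k x -> differentiable phi x ->
  differentiable (fun y => k y *: phi y) x.
Proof.
move=> dk dphi.
(* Expanding in coordinates reduces the claim to products of real-valued functions. *)
have -> : (fun y => k y *: phi y) =
    \sum_i (fun y => (k y * phi y ord0 i) *: delta_mx ord0 i).
  apply/funext => y; rewrite fct_sumE [phi y in LHS]row_sum_delta scaler_sumr.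
  by apply: eq_bigr => i _; rewrite scalerA.
apply: differentiable_sum => i; apply: differentiableZl.
apply: differentiableM => //.
exact: (differentiable_comp dphi (differentiable_coord _ _ _)).
Qed.

Lemma differentiable_ln (r : R) : 0 < r -> differentiable (@ln R) r.
Proof. by move=> r0; apply/derivable1_diffP; case: (is_derive1_ln r0). Qed.

Lemma differentiable_expR (r : R) : differentiable (@expR R) r.
Proof. by apply/derivable1_diffP; case: (is_derive_expR r). Qed.

Lemma is_diff_expR_comp f x g : is_diff x f (dot g) ->
  is_diff x (expR \o f) (dot (expR (f x) *: g)).
Proof.
move=> df; have dfx := @ex_diff _ _ _ _ _ _ _ df.
have dexp := differentiable_expR (f x).
split; first exact: differentiable_comp.
rewrite diff_comp // (@diff_val _ _ _ _ _ _ _ df); apply/funext => v /=.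
rewrite deriv1E; last by case: (is_derive_expR (f x)).
by rewrite derive1E (@derive_val _ _ _ _ _ _ _ (is_derive_expR _)) dotZl mulrC.
Qed.

End Gradient.

(** * Priors with a prescribed gradient of the logarithm *)

Theorem theorem2 (R : realType) (p : nat) (a b : 'I_p -> \bar R)
    (hab : forall i, (a i < b i)%E)
    (phi : 'rV[R]_p -> 'rV[R]_p)
    (phi_diff : differentiable_on (rectangle a b) phi)
    (phi_interchange : diff_int_interchange (rectangle a b) phi) :
  (exists prior : 'rV[R]_p -> R,
     [/\ prior_density (rectangle a b) prior,
         twice_differentiable_on (rectangle a b) prior &
         forall theta, rectangle a b theta ->
           gradient (fun x => ln (prior x)) theta = phi theta])
  <->
  (forall theta, rectangle a b theta -> forall t u : 'I_p,
     partial u (component phi t) theta = partial t (component phi u) theta).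
Proof.
set K := rectangle a b.
have Ko : open K := @rectangle_open R p a b.
have Kc : segment_closed K := @rectangle_segment_closed R p a b.
have phic w (Kw : K w) : {for w, continuous phi}.
  exact: differentiable_continuous (phi_diff _ Kw).
split=> [[prior [prior_gt0 [dprior _] gradE]] theta Ktheta|sym].
  (* Necessity: [ln] of the prior is a potential of [phi], so every circulation vanishes. *)
  apply/(diff_symmetricP (phi_diff _ Ktheta)).
  apply: (diff_symmetric_of_circulation Ko Kc phi_diff) Ktheta => x y z.
  apply: (circulation_of_potential (F := fun x => ln (prior x)) Kc phic) => w Kw.
  rewrite -gradE //; apply: diff_gradient.
  apply: (@differentiable_comp _ _ _ _ prior (@ln R)); first exact: dprior.
  exact/differentiable_ln/prior_gt0.
(* Sufficiency: a base point for the potential is chosen; without one, the constant prior satisfies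
   every condition vacuously. *)
have [[c Kbase]|K0] := pselect (exists c, K c); last first.
  have nK x : ~ K x by move=> Kx; apply: K0; exists x.
  by exists (cst 1); split=> [x /nK|| x /nK] //; split=> x /nK.
have circ0 x y z : K x -> K y -> K z -> circulation phi x y z = 0.
  move=> Kx Ky Kz; have [l [h [lhK lx ly lz]]] := rectangle_box Kx Ky Kz.
  apply: (@goursat _ _ (box l h)) => //.
  - exact: box_closed.
  - exact: box_segment_closed.
  - by move=> w /lhK; exact: phi_diff.
  - by move=> w /lhK Kw; apply/(diff_symmetricP (phi_diff _ Kw)); exact: sym.
pose F := segint phi c.
have dF w (Kw : K w) : is_diff w F (dot (phi w)) by exact: (@is_diff_potential _ _ K).
have dprior w (Kw : K w) := is_diff_expR_comp (dF w Kw).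
exists (expR \o F); split.
- by move=> w _ /=; exact: expR_gt0.
- split=> w Kw; first exact: (@ex_diff _ _ _ _ _ _ _ (dprior w Kw)).
  (* On [K] the gradient of the prior is the prior times [phi], a product of differentiable
     functions; openness of [K] gives this equality near [w]. *)
  apply: (@near_eq_differentiable _ _ _ (fun y => expR (F y) *: phi y)).
    have : nbhs w K by exact: open_nbhs_nbhs.
    by apply: filterS => y Ky; rewrite (gradient_diff (dprior y Ky)).
  apply: differentiable_scale; last exact: phi_diff.
  exact: (@ex_diff _ _ _ _ _ _ _ (dprior w Kw)).
- move=> w Kw; have -> : (fun x => ln ((expR \o F) x)) = F.
    by apply/funext => x /=; rewrite expRK.
  exact: gradient_diff (dF w Kw).
Qed.
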